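(* Let $G=(V,E)$ be a ribbon graph with $|E|=n$, let $G_m$ be its medial graph, and let $o:E\to[n]$ be a bijection. Let $(U,\Omega)$ be the $(n,3)$-carrier in which $U$ is the set of all transitions of $G_m$ and each class of $\Omega$ consists of the three transitions at one vertex of $G_m$. Then $$\operatorname{Orb}(D_o(G))=\{D_{Z(G_m),\tau',\sigma'}\mid \tau'\in\mathbb{T}_{(U,\Omega)},\ \sigma'\in\mathbb{P}_{(U,\Omega)}\}.$$
   Context: Group action. A set system on $[n]=\{1,\dots,n\}$ is a pair $D=([n],\mathcal{F})$, $\mathcal{F}$ a collection of subsets of $[n]$. For $i\in[n]$: $D\ast i=([n],\{X\triangle\{i\}:X\in\mathcal{F}\})$ and $D+i=([n],\mathcal{F}\triangle\{I\cup\{i\}:I\in\mathcal{F},i\notin I\})$. For fixed $i$ these satisfy the relations of $\mathcal{G}=\langle\ast,+\mid\ast^2,+^2,(\ast+)^3\rangle\cong S_3$. For a word $g=g_1\cdots g_k$, $D\,g\,i:=(\cdots(D\,g_k\,i)\cdots)g_1\,i$. Operations on distinct elements commute. For $\hat g=(g_1,\dots,g_n)\in\mathcal{G}^n$, $\hat g\cdot D$ is obtained by applying $g_i$ to $i$ for all $i$. For $\pi\in S_n$, $D_\pi=([n],\{\pi(I):I\in\mathcal{F}\})$. The semidirect product $\mathcal{G}^n\rtimes_\phi S_n$, with $(\hat g,\pi_1)(\hat h,\pi_2)=(\hat g\circ\hat h\pi_1^{-1},\pi_1\pi_2)$, $\circ$ componentwise, $(\hat h\pi^{-1})(i)=h_{\pi^{-1}(i)}$,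 acts on set systems by $(\hat g,\pi)D=\hat g\cdot D_\pi$; $\operatorname{Orb}(D)$ is the orbit of $D$. Ribbon graphs. A ribbon graph $G=(V,E)$ is a surface with boundary that is the union of a set $V$ of discs (vertices) and a set $E$ of discs (edges) such that vertices and edges intersect in disjoint line segments, each such segment lies on the boundary of exactly one vertex and exactly one edge, and each edge contains exactly two such segments. A spanning ribbon subgraph is obtained by removing only edges. A spanning quasi-tree of a connected $G$ is a connected spanning ribbon subgraph with exactly one boundary component; for disconnected $G$, a spanning quasi-tree is a spanning ribbon subgraph $Q$ with $k(Q)=k(G)$ whose components are spanning quasi-trees of the components of $G$ ($k$ = number of connected components). The delta-matroid of $G$ is $D_o(G)=([n],\mathcal{F}(G))$ with $\mathcal{F}(G)=\{F\subseteq[n]: o^{-1}(F)\text{ is the edge set of a spanning quasi-tree of }G\}$. Medial graph. $G_m$ is the $4$-regular graph obtained by placing a vertex $v_e$ on each edge $e$ of $G$ and drawing the edges of $G_m$ along the face boundaries (boundary components) of $G$, i.e. one edge of $G_m$ for each pair of consecutive edge-ends around a vertex of $G$, joining the corresponding vertices $v_e$, $v_f$. An isolated vertex of $G$ contributes a free loop (a circular edge without vertices, counted as a connected component). Transitions. For a $4$-regular graph $F$, a transition at a vertex $v$ is a partition of the four half-edges at $v$ into two pairs (three transitions per vertex). With $U$ the set of all transitions of $F$ and $\Omega$ the partition of $U$ by vertices, a transversal of $\Omega$ (a subset of $U$ containing exactly one element of each class; the set of these is $\mathcal{T}(\Omega)$) is a choice $T$ of transition at each vertex; $F|_T$ is the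 $2$-regular graph obtained by splitting every vertex $v$ into two vertices, each incident with one pair of half-edges of the chosen transition. Put $\mathcal{B}(F)=\{T\in\mathcal{T}(\Omega): k(F|_T)=k(F)\}$, and $Z(F)=(U,\Omega,\mathcal{B}^*(F))$, where $\mathcal{B}^*(F)=\{I: I\subseteq B\text{ for some }B\in\mathcal{B}(F)\}$; this is a tight $3$-matroid with set of bases $\mathcal{B}(F)$. From $3$-matroids to set systems. A transversal $3$-tuple is an ordered triple $(T_1,T_2,T_3)$ of mutually disjoint transversals with union $U$; $\mathbb{T}_{(U,\Omega)}$ is the set of them. A projection is a surjection $\sigma:U\to[n]$ with $\sigma(x)=\sigma(y)$ iff $x,y$ lie in the same class of $\Omega$; $\mathbb{P}_{(U,\Omega)}$ is the set of them. For a tight $3$-matroid $Z$ on $(U,\Omega)$ with set of bases $\mathcal{B}_Z$, $\tau=(T_1,T_2,T_3)$ and $\sigma$, $$D_{Z,\tau,\sigma}=([n],\{\sigma(X\cap T_2)\mid X\in\mathcal{B}_Z,\ X\subseteq T_1\cup T_2\}).$$ *)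

(* Defs.v *)
From HB Require Import structures.
From mathcomp Require Import all_boot all_fingroup.
Set Implicit Arguments.
Unset Strict Implicit.
Unset Printing Implicit Defensive.

(* A set system on [n] is its collection of feasible sets; the ground set
   {1, .., n} is 'I_n. *)
Definition setsystem (n : nat) := {set {set 'I_n}}.

Definition symdiff (T : finType) (A B : {set T}) : {set T} :=
  (A :\: B) :|: (B :\: A).

Section Twists.
Variable n : nat.
Implicit Types (D : setsystem n) (i j : 'I_n) (X : {set 'I_n}).

Definition partial_dual D i : setsystem n :=
  [set symdiff X [set i] | X in D].

Definition loop_compl D i : setsystem n :=
  symdiff D [set i |: I | I : {set 'I_n} in D & i \notin I].

(* Elements of the group <s, p | s^2, p^2, (sp)^3> are represented by words in
   s = Star and p = Plus.  The generators are involutions, so every element is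
   represented by a word, and the relators act trivially (partial_dualK,
   loop_complK and twist_braid below), so the action of a word depends only on
   the group element which it represents. *)
Inductive generator := Star | Plus.
Definition word := seq generator.

Definition generator_act (g : generator) D i : setsystem n :=
  match g with Star => partial_dual D i | Plus => loop_compl D i end.

(* D (g_1 .. g_k) i: the last letter acts first. *)
Definition word_act (w : word) D i : setsystem n :=
  foldr (fun g D' => generator_act g D' i) D w.

(* Apply gh i to i for all i; the order is irrelevant by word_actC. *)
Definition hat_act (gh : 'I_n -> word) D : setsystem n :=
  foldr (fun i D' => word_act (gh i) D' i) D (enum 'I_n).

Definition relabel D (p : 'S_n) : setsystem n :=
  [set p @: I | I : {set 'I_n} in D].

Definition semidirect_act (a : ('I_n -> word) * 'S_n) D : setsystem n :=
  hat_act a.1 (relabel D a.2).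

(* Orb D D' : the set system D' lies in the orbit of D. *)
Definition Orb D (D' : setsystem n) : Prop :=
  exists a : ('I_n -> word) * 'S_n, D' = semidirect_act a D.

Lemma in_symdiff (T : finType) (A B : {set T}) x :
  (x \in symdiff A B) = (x \in A) (+) (x \in B).
Proof. by rewrite !inE; case: (x \in A); case: (x \in B). Qed.

Lemma symdiffK (T : finType) (B : {set T}) : involutive (fun A => symdiff A B).
Proof. by move=> A; apply/setP=> x; rewrite !in_symdiff addbK. Qed.

Lemma in_partial_dual D i X :
  (X \in partial_dual D i) = (symdiff X [set i] \in D).
Proof.
apply/imsetP/idP=> [[Y YD ->]|XD]; first by rewrite symdiffK.
by exists (symdiff X [set i]); rewrite // symdiffK.
Qed.

Lemma in_loop_compl D i X :
  (X \in loop_compl D i) =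
  (X \in D) (+) ((i \in X) && (symdiff X [set i] \in D)).
Proof.
rewrite in_symdiff; congr (_ (+) _).
have toggle (I : {set 'I_n}) : i \notin I -> i |: I = symdiff I [set i].
  move=> iI; apply/setP=> x; rewrite in_symdiff !inE.
  by case: eqVneq => [->|_]; rewrite ?(negPf iI) ?addbF.
apply/imsetP/andP=> [[I /[!inE] /andP[ID iI] ->]|[iX XD]].
  by rewrite setU11 toggle // symdiffK.
have iX' : i \notin symdiff X [set i] by rewrite in_symdiff inE eqxx iX.
by exists (symdiff X [set i]); rewrite ?toggle ?symdiffK // inE XD.
Qed.

Lemma partial_dualK D i : partial_dual (partial_dual D i) i = D.
Proof. by apply/setP=> X; rewrite !in_partial_dual symdiffK. Qed.

Lemma loop_complK D i : loop_compl (loop_compl D i) i = D.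
Proof.
apply/setP=> X; rewrite !in_loop_compl symdiffK in_symdiff !inE eqxx.
by case: (i \in X); case: (X \in D); case: (symdiff X [set i] \in D).
Qed.

Lemma twist_braid D i :
  word_act [:: Star; Plus; Star; Plus; Star; Plus] D i = D.
Proof.
apply/setP=> X; rewrite /=.
do 3 rewrite ?(in_partial_dual, in_loop_compl) ?symdiffK.
rewrite ?in_symdiff ?inE ?eqxx.
by case: (i \in X); case: (X \in D); case: (symdiff X [set i] \in D).
Qed.

Lemma word_actC (w1 w2 : word) D i j : i != j ->
  word_act w1 (word_act w2 D j) i = word_act w2 (word_act w1 D i) j.
Proof.
move=> ij.
have ji : j != i by rewrite eq_sym.
have sC (X : {set 'I_n}) : symdiff (symdiff X [set i]) [set j] =
            symdiff (symdiff X [set j]) [set i].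
  by apply/setP=> x; rewrite !in_symdiff addbAC.
have gC g1 g2 D1 : generator_act g1 (generator_act g2 D1 j) i =
                   generator_act g2 (generator_act g1 D1 i) j.
  apply/setP=> X; case: g1; case: g2; rewrite /= !(in_partial_dual,
    in_loop_compl) ?in_symdiff ?inE ?(negPf ij) ?(negPf ji) ?addbF sC //.
  case: (i \in X); case: (j \in X); rewrite /= ?addbF //.
  by rewrite !addbA; congr (_ (+) _); rewrite addbAC.
have gwC g D1 : generator_act g (word_act w2 D1 j) i =
                word_act w2 (generator_act g D1 i) j.
  by elim: w2 => //= h w2 IH; rewrite gC IH.
by elim: w1 => //= g w1 ->; rewrite gwC.
Qed.

End Twists.

(* Each edge disc of a ribbon graph is a rectangle, two opposite sides of which
   are the segments that it shares with vertex discs.  The flag (e, h, s) is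
   the corner of the rectangle e at its end h on its side s. *)
Definition flag (E : finType) := (E * bool * bool)%type.

(* The other endpoint of the segment shared with a vertex disc. *)
Definition across (E : finType) (x : flag E) : flag E :=
  let: (e, h, s) := x in (e, h, ~~ s).

(* The other endpoint of the free side of the edge disc. *)
Definition along (E : finType) (x : flag E) : flag E :=
  let: (e, h, s) := x in (e, ~~ h, s).

(* Ribbon graphs up to homeomorphism.  The boundary circle of a vertex disc
   which meets an edge is cut by the flags into the shared segments, which
   join x to across x, and the remaining arcs, which join x to corner x and
   thus lie between consecutive edge-ends; such circles are therefore the
   classes of the equivalence generated by across and corner.  A vertex which
   is not in the image of rg_vert is an isolated vertex. *)
Record ribbon_graph (V E : finType) := RibbonGraph {
  rg_corner : flag E -> flag E;
  rg_vert : flag E -> V;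
  rg_cornerK : involutive rg_corner;
  rg_corner_neq : forall x, rg_corner x != x;
  rg_vertP : forall x y, (rg_vert x == rg_vert y) =
    connect (fun x y => (y == rg_corner x) || (y == across x)) x y
}.

Section RibbonGraphTheory.
Variables (V E : finType) (G : ribbon_graph V E).

Definition isolated_vertices : {set V} :=
  [set v | v \notin codom (rg_vert G)].

(* A spanning ribbon subgraph (V, A) is given by its edge set A. *)
Implicit Types (A : {set E}) (C : {set V}).

Definition rg_adj A : rel V := fun v w =>
  [exists x : flag E,
    [&& x.1.1 \in A, rg_vert G x == v & rg_vert G (along x) == w]].

Definition rg_ncomp A : nat := n_comp (rg_adj A) V.

Definition rg_comp A (v : V) : {set V} := [set w | connect (rg_adj A) v w].

(* The arcs which make up the boundary of the surface (V, A): the corner arcs,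
   the free sides of the edges in A, and the segments along which the edges
   not in A were attached. *)
Definition boundary_arc A : rel (flag E) := fun x y =>
  (y == rg_corner G x) || (y == if x.1.1 \in A then along x else across x).

(* The number of boundary components of the part of (V, A) on the vertex set C
   (a union of components of (V, A)).  The boundary circle of an isolated
   vertex of G carries no flag. *)
Definition nboundary A C : nat :=
  n_comp (boundary_arc A) [pred x | rg_vert G x \in C]
  + #|C :&: isolated_vertices|.

Definition spanning_quasi_tree A : bool :=
  (rg_ncomp A == rg_ncomp [set: E]) &&
  [forall v, (rg_comp A v == rg_comp [set: E] v)
             && (nboundary A (rg_comp A v) == 1)].

Definition delta_matroid (n : nat) (o : E -> 'I_n) : setsystem n :=
  [set F : {set 'I_n} | spanning_quasi_tree (o @^-1: F)].

End RibbonGraphTheory.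

(* A 4-regular graph, possibly with loops, multiple edges and free loops.  A
   vertex is the set of half-edges incident with it, and an edge is an orbit
   {h, mate h}. *)
Record graph4 := Graph4 {
  half_edge : finType;
  mate : half_edge -> half_edge;
  vertices : {set {set half_edge}};
  free_loops : nat;
  mateK : involutive mate;
  mate_neq : forall h, mate h != h;
  verticesP : partition vertices [set: half_edge];
  vertices4 : forall v, v \in vertices -> #|v| = 4
}.
Arguments mate {g} h.

(* The number of connected components of the graph whose vertices are the
   blocks in P, with edges {h, m h} and l free loops. *)
Definition ncomponents (H : finType) (m : H -> H) (P : {set {set H}}) (l : nat)
  : nat :=
  n_comp (fun B C => [&& B \in P, C \in P & [exists h in B, m h \in C]]) P + l.

Section Transitions.
Variable F : graph4.

Definition transition_at (v : {set half_edge F}) (p : {set {set half_edge F}})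
  : bool :=
  partition p v && [forall B in p, #|B| == 2].

Definition transition : finType :=
  {p : {set {set half_edge F}} | [exists v in vertices F, transition_at v p]}.

Definition transition_classes : {set {set transition}} :=
  [set [set t : transition | transition_at v (val t)] | v in vertices F].

(* The vertices of F|_T. *)
Definition split_vertices (T : {set transition}) : {set {set half_edge F}} :=
  \bigcup_(t in T) val t.

Definition graph_bases : {set {set transition}} :=
  [set T | is_transversal T transition_classes [set: transition] &
    ncomponents mate (split_vertices T) (free_loops F)
    == ncomponents mate (vertices F) (free_loops F)].

(* The independent sets of Z(F). *)
Definition graph_3matroid : {set {set transition}} :=
  [set I : {set transition} |
    [exists B : {set transition} in graph_bases, I \subset B]].

End Transitions.

Section Carrier.
Variables (U : finType) (Omega : {set {set U}}).

Definition transversal_3tuple (tau : {set U} * {set U} * {set U}) : Prop :=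
  let: (T1, T2, T3) := tau in
  [/\ [/\ is_transversal T1 Omega [set: U],
          is_transversal T2 Omega [set: U] &
          is_transversal T3 Omega [set: U]],
      [/\ [disjoint T1 & T2], [disjoint T1 & T3] & [disjoint T2 & T3]] &
      T1 :|: T2 :|: T3 = [set: U]].

Definition projection (n : nat) (sigma : U -> 'I_n) : Prop :=
  (forall i, exists x, sigma x = i) /\
  (forall x y, sigma x = sigma y <->
    exists2 w, w \in Omega & (x \in w) && (y \in w)).

Definition bases (indep : {set {set U}}) : {set {set U}} :=
  [set X | maxset (fun I : {set U} => I \in indep) X].

(* D_{Z, tau, sigma}, with Z given by its independent sets. *)
Definition matroid_setsystem (n : nat) (indep : {set {set U}})
    (tau : {set U} * {set U} * {set U}) (sigma : U -> 'I_n) : setsystem n :=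
  let: (T1, T2, T3) := tau in
  [set sigma @: (X :&: T2) | X : {set U} in bases indep & X \subset T1 :|: T2].

End Carrier.

Section Medial.
Variables (V E : finType) (G : ribbon_graph V E).

(* The half-edges at the medial vertex v_e are the four corners of e. *)
Definition medial_vertices : {set {set flag E}} :=
  [set [set x : flag E | x.1.1 == e] | e : E].

Lemma medial_verticesP : partition medial_vertices [set: flag E].
Proof.
rewrite (_ : medial_vertices = preim_partition (fun x : flag E => x.1.1) setT).
  exact: preim_partitionP.
apply/setP=> B; apply/imsetP/imsetP=> [[e _ ->]|[x _ ->]].
  by exists (e, true, true) => //; apply/setP=> y; rewrite !inE eq_sym.
by exists x.1.1 => //; apply/setP=> y; rewrite !inE eq_sym.
Qed.

Lemma medial_vertices4 v : v \in medial_vertices -> #|v| = 4.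
Proof.
case/imsetP=> e _ ->.
rewrite (_ : [set x : flag E | _] = setX (setX [set e] setT) setT).
  by rewrite !cardsX cards1 cardsT card_bool.
by apply/setP=> -[[e' h] s]; rewrite !inE !andbT.
Qed.

(* The edges of the medial graph are the corner arcs. *)
Definition medial_graph : graph4 :=
  Graph4 #|isolated_vertices G| (rg_cornerK G) (rg_corner_neq G)
    medial_verticesP medial_vertices4.

End Medial.

(* Main.v *)
(* A smoothing of the medial graph chooses at every edge of [G] one of the three
   pairings of the four corners of the edge disc: along the vertices, along the
   edge, or crosswise.  The circles of the smoothing that pairs along the edges
   in [A] and along the vertices elsewhere are the boundary components of
   [(V, A)], so [A] is a spanning quasi-tree iff that smoothing is a basis of
   [Z(G_m)]: [D_o(G)] is the set system obtained from one choice of a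
   transversal 3-tuple.

   Cutting a smoothing open at an edge leaves two paths ending at the four
   corners of that edge.  One pairing there closes them up separately, the other
   two join them; hence among the three smoothings that differ only at this edge
   either none or exactly two are bases.  By this parity, [*] at [i] exchanges
   the pairings in the first two transversals and [+] those in the last two.
   These two transpositions generate all orderings of the three pairings, and
   relabelling gives all projections. *)

Require Import Defs.
From mathcomp Require Import all_boot all_fingroup.

Set Implicit Arguments.
Unset Strict Implicit.
Unset Printing Implicit Defensive.

(** * Comparing component counts of two relations *)

Section Connectivity.
Variable T : finType.
Implicit Types (e : rel T) (a : {pred T}).

(** As [e'] is coarser, [root e'] maps the roots of [e] onto those of [e']. Equal counts make this
    surjection injective, so points connected by [e'] already share their [e]-root. *)
Lemma eq_connect_n_comp e e' : connect_sym e -> connect_sym e' ->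
  subrel (connect e) (connect e') ->
  (n_comp e T == n_comp e' T) = [forall x, forall y, connect e' x y ==> connect e x y].
Proof.
move=> sym_e sym_e' see'; apply/eqP/forallP=> [eq_n x|ee'].
  apply/forallP=> y; apply/implyP=> xy.
  have inj_root : {in [pred z | roots e z] &, injective (root e')}.
    apply/image_injP; rewrite eqn_leq leq_image_card /=.
    have /eq_leq : #|[pred z | roots e z]| = n_comp e' T.
      by rewrite -eq_n; apply: eq_card => z; rewrite !inE andbT.
    move/leq_trans; apply; apply: subset_leq_card.
    apply/subsetP=> z; rewrite !inE andbT => /eqP rz.
    apply/imageP; exists (root e z); first exact: roots_root.
    by rewrite -[LHS]rz; apply/rootP=> //; apply/see'/connect_root.
  rewrite -(root_connect sym_e); apply/eqP/inj_root; rewrite ?inE ?roots_root //.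
  apply/rootP=> //.
  have rc z : connect e' (root e z) z by rewrite sym_e'; apply/see'/connect_root.
  by apply: connect_trans (rc x) (connect_trans xy _); rewrite sym_e'.
apply: eq_n_comp => x y; apply/idP/idP; first exact: see'.
by apply/implyP; have /forallP := ee' x.
Qed.

Lemma n_comp1_connect e a : connect_sym e -> closed e a -> n_comp e a = 1 ->
  {in a &, forall x y, connect e x y}.
Proof.
move=> sym_e cl_a n1 x y xa ya; rewrite -(root_connect sym_e); apply/eqP.
have /card_le1_eqP : #|predI (roots e) (mem a)| <= 1 by apply: eq_leq n1.
have ra z : z \in a -> root e z \in predI (roots e) (mem a).
  by move=> za; rewrite !inE roots_root //= -(closed_connect cl_a (connect_root e z)).
by apply; apply: ra.
Qed.
End Connectivity.

(** * Paths generated by two involutions *)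

Section Dihedral.
Variables (T : finType) (c t : T -> T).
Hypotheses (cK : involutive c) (tK : involutive t) (c_neq : forall x, c x != x).

Definition dihedral : rel T := fun x y => (y == c x) || (y == t x).

Lemma dihedral_sym : connect_sym dihedral.
Proof.
apply: sym_connect_sym => x y.
by rewrite /dihedral ![y == _]eq_sym (canF_eq cK) (canF_eq tK).
Qed.

(* A fixed point [a] of [t] is an end of its [dihedral]-path, whose points are
   the iterates of [c \o t] at [a]; [t] acts on them by reversing exponents, so
   it fixes exactly one more point, halfway along the cycle. *)
Lemma dihedral_path_end a : t a = a ->
  exists b, [/\ b != a, t b = b, connect dihedral a b &
    forall y, t y = y -> connect dihedral a y -> y = a \/ y = b].
Proof.
move=> ta; pose f := c \o t; pose m := fingraph.order f a.
have injf : injective f by apply: inj_comp; apply: inv_inj.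
have fm : iter m f a = a by apply: iter_order.
have injk k : injective (iter k f).
  by elim: k => // k IHk x y /= /injf /IHk.
have fconn z : connect dihedral z (f z).
  apply: (@connect_trans _ _ (t z)); apply: connect1; rewrite /dihedral /=.
    by rewrite eqxx orbT.
  by rewrite eqxx.
have kconn k : connect dihedral a (iter k f a).
  by elim: k => //= k IHk; apply: connect_trans IHk (fconn _).
have conn_orbit y : connect dihedral a y -> fconnect f a y.
  have fsym := fconnect_sym injf.
  (* Asking for [c z] in the [f]-orbit as well makes the set stable under both involutions. It
     contains [a] because [c a = f a]. *)
  have cl : closed dihedral [pred z | fconnect f a z && fconnect f a (c z)].
    apply: (intro_closed dihedral_sym) => z w.
    rewrite !inE => /orP[]/eqP-> /andP[az acz]; first by rewrite cK az acz.
    have at_ : fconnect f a (t z).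
      apply: connect_trans acz _; rewrite fsym.
      by have := fconnect1 f (t z); rewrite /f /= tK.
    by rewrite at_ /=; apply: connect_trans az _; apply: fconnect1.
  move=> /(closed_connect cl); rewrite !inE connect0 /=.
  have -> : fconnect f a (c a) by rewrite -{2}ta; apply: fconnect1.
  by case/esym/andP.
have revt k : iter k f (t (iter k f a)) = a.
  elim: k => [|k IHk] //=.
  by rewrite -iterS iterSr /f /= tK cK IHk.
have revc k : iter k f (c (iter k.+1 f a)) = a.
  by rewrite /= /f /= cK revt.
have small k : 0 < k < m -> iter k f a != a.
  case/andP=> k0 km; apply/eqP=> fk.
  by have := findex_iter km; rewrite fk findex0 => k_eq; rewrite -k_eq in k0.
have m0 : 0 < m by apply: fingraph.order_gt0.
(* For odd [m], the involution [c] would fix the point with exponent [m./2.+1]. *)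
have [j mE] : exists j, m = j.*2.
  case: (boolP (odd m)) => [om|em]; last first.
    by exists m./2; rewrite -[LHS]odd_double_half (negPf em).
  have mE : m = m./2.+1 + m./2 by rewrite addSn addnn -[LHS]odd_double_half om.
  have aE : iter m./2 f (iter m./2.+1 f a) = a by rewrite -iterD addnC -mE.
  have /injk /eqP := etrans (revc m./2) (esym aE).
  by rewrite (negPf (c_neq _)).
have j0 : 0 < j by rewrite -double_gt0 -mE.
have jm : j < m by rewrite mE -addnn -{1}[j]addn0 ltn_add2l.
exists (iter j f a); split; first by rewrite small ?j0.
- by apply: (injk j); rewrite revt -iterD addnn -mE.
- exact: kconn.
move=> y ty /conn_orbit ay; have := iter_findex ay; have := findex_max ay.
rewrite -/m; set k := findex f a y => km ky.
(* A fixed point of [t] with exponent [k < m] has [k.*2] divisible by [m], so [k] is [0] or [j]. *)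
have f2k : iter k.*2 f a = a by have := revt k; rewrite ky ty -ky -iterD addnn.
have [k0|k0] := posnP k; first by left; rewrite -ky k0.
have [k2m|mk2|k2m] := ltngtP k.*2 m; last by right; move: k2m ky; rewrite mE => /double_inj->.
  by have /small : 0 < k.*2 < m by [rewrite double_gt0 k0]; rewrite f2k eqxx.
have /small : 0 < k.*2 - m < m.
  by rewrite subn_gt0 mk2 ltn_subLR ?(ltnW mk2) // addnn ltn_double.
by rewrite -{1}fm -iterD subnK ?f2k ?eqxx // ltnW.
Qed.
End Dihedral.

(* The three ways to pair off the four corners of an edge disc, [None] being the
   pairing of opposite corners. *)
Definition pairing := option bool.
Definition by_across : pairing := Some false.
Definition by_along : pairing := Some true.
Definition crossing : pairing := None.

(** * Pairings of the corners of an edge disc *)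

Section Pairings.
Variable E : finType.
Implicit Types (x y : flag E) (k : pairing).

(** The corners form a torsor under the Klein four-group, and the three pairings are its nonzero
    elements: [by_across] flips the side, [by_along] the end, [crossing] both. *)
Definition partner k x : flag E :=
  let: (e, h, s) := x in (e, h (+) (k != by_across), s (+) (k != by_along)).

Lemma partner_across x : partner by_across x = across x.
Proof. by case: x => [[e h] s] /=; rewrite addbF addbT. Qed.

Lemma partner_along x : partner by_along x = along x.
Proof. by case: x => [[e h] s] /=; rewrite addbF addbT. Qed.

Lemma partnerK k : involutive (partner k).
Proof. by move=> [[e h] s] /=; rewrite !addbK. Qed.

Lemma partner_edge k x : (partner k x).1.1 = x.1.1.
Proof. by case: x => [[]]. Qed.

Lemma partner_neq k x : partner k x != x.
Proof. by case: x k => [[e []] []] [[]|]; rewrite !xpair_eqE ?andbF. Qed.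

Lemma partner_inj k k' x : partner k x = partner k' x -> k = k'.
Proof. by case: x k k' => [[e []] []] [[]|] [[]|] /eqP; rewrite ?eqxx ?xpair_eqE ?andbF. Qed.

Lemma partner_comp k k' l x : uniq [:: k; k'; l] ->
  partner k (partner k' x) = partner l x.
Proof. by case: x k k' l => [[e []] []] [[]|] [[]|] [[]|]. Qed.

Lemma same_edgeP x y : x.1.1 = y.1.1 -> x = y \/ exists k, y = partner k x.
Proof.
case: x y => [[e h] s] [[e' h'] s'] /= <-.
case: (eqVneq h h') => [->|hh']; case: (eqVneq s s') => [->|ss']; first by left.
- by right; exists by_across; case: s s' ss' => [] []; case: h'.
- by right; exists by_along; case: h h' hh' => [] []; case: s'.
by right; exists crossing; case: h h' hh' => [] []; case: s s' ss' => [] [].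
Qed.

Lemma third_pairing k k' : k != k' -> exists l, uniq [:: k; k'; l].
Proof.
by case: k k' => [[]|] [[]|] // _;
  by [exists crossing | exists by_along | exists by_across].
Qed.

End Pairings.

(** * Circles of a smoothing and the parity of bases *)

Section Circles.
Variables (V E : finType) (G : ribbon_graph V E).
Notation corner := (rg_corner G).
Implicit Types (x y : flag E) (k : pairing) (t : {ffun E -> pairing}) (e : E).

Definition smooth t x := partner (t x.1.1) x.

Lemma smoothK t : involutive (smooth t).
Proof. by move=> x; rewrite /smooth partner_edge partnerK. Qed.

Definition circle_arc t : rel (flag E) := dihedral corner (smooth t).

Lemma circle_arc_sym t : connect_sym (circle_arc t).
Proof. by apply: dihedral_sym; [apply: rg_cornerK | apply: smoothK]. Qed.

(* The circles of the smoothing [t] are as few as possible, namely one for each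
   component of the medial graph. *)
Definition basis t : bool :=
  [forall x, forall y, (x.1.1 == y.1.1) ==> connect (circle_arc t) x y].

Lemma basisP t :
  reflect (forall x y, x.1.1 = y.1.1 -> connect (circle_arc t) x y) (basis t).
Proof.
apply: (iffP forallP) => [b x y xy|b x].
  by have /forallP/(_ y)/implyP := b x; apply; apply/eqP.
by apply/forallP=> y; apply/implyP=> /eqP; apply: b.
Qed.

Definition upd t e k : {ffun E -> pairing} :=
  [ffun e' => if e' == e then k else t e'].

(* The corners of [e] become fixed points, that is, ends of paths. *)
Definition cut t e x := if x.1.1 == e then x else smooth t x.

Lemma cutK t e : involutive (cut t e).
Proof.
rewrite /cut => x; case: (eqVneq x.1.1 e) => [->|xe]; first by rewrite eqxx.
by rewrite /smooth !partner_edge (negPf xe) partnerK.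
Qed.

Lemma cut_subrel t e k :
  subrel (connect (dihedral corner (cut t e))) (connect (circle_arc (upd t e k))).
Proof.
apply: connect_sub => x y /orP[/eqP->|/eqP->].
  by apply: connect1; rewrite /circle_arc /dihedral eqxx.
rewrite /cut; case: eqVneq => [_|xe]; first exact: connect0.
by apply: connect1; rewrite /circle_arc /dihedral /smooth ffunE (negPf xe) eqxx orbT.
Qed.

(* Cutting [e] open leaves two paths whose four ends are the corners of [e].
   The pairing of these corners by the paths is the only one at [e] that does
   not join the paths to a single circle. *)
Lemma cut_pairing t e : exists k0, forall x k, x.1.1 = e ->
  connect (dihedral corner (cut t e)) x (partner k x) = (k == k0).
Proof.
have csym := dihedral_sym (rg_cornerK G) (cutK t e).
have cut_id y : y.1.1 = e -> cut t e y = y by rewrite /cut => ->; rewrite eqxx.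
have edge_id y : cut t e y = y -> y.1.1 = e.
  rewrite /cut; case: eqVneq => // ye /eqP; rewrite /smooth.
  by rewrite (negPf (partner_neq _ _)).
have ends x : x.1.1 = e -> exists k0, forall k,
    connect (dihedral corner (cut t e)) x (partner k x) = (k == k0).
  move=> xe.
  have [b [bx tb xb only]] := dihedral_path_end (rg_cornerK G) (cutK t e)
    (rg_corner_neq G) (cut_id x xe).
  have [bx'|[k0 bE]] : x = b \/ exists k, b = partner k x.
  - by apply: same_edgeP; rewrite xe edge_id.
  - by rewrite bx' eqxx in bx.
  exists k0 => k; apply/idP/eqP=> [xk|->]; last by rewrite -bE.
  have [|/eqP|] := only (partner k x) _ xk; first by rewrite cut_id // partner_edge.
  - by rewrite (negPf (partner_neq _ _)).
  by rewrite bE => /partner_inj.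
(* [k0] is read off at one corner; it remains to see that the paths pair every other corner [x] of
   [e] in the same way. *)
have [k0 x0P] := ends (e, false, false) erefl; exists k0.
move=> x k xe; have [kx xP] := ends x xe; rewrite xP; congr (k == _).
have [x0x|[k' xE]] : (e, false, false) = x \/ exists k, x = partner k (e, false, false).
- exact: same_edgeP.
- by apply/eqP; rewrite -x0P x0x xP.
have [k'0|k'0] := eqVneq k' k0.
  apply/esym/eqP; rewrite -xP -k'0 {2}xE partnerK csym xE x0P k'0.
  by rewrite eqxx.
(* Here [x] is off the path through the first corner. With [kx != k0] its own path would end at that
   corner, if [kx = k'], or else at the other end of that corner's path. *)
have [//|kx0] := eqVneq kx k0.
have := xP kx; rewrite eqxx.
have conn0 l : connect (dihedral corner (cut t e)) x (partner l (e, false, false)) -> l != k0.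
  move=> xl; apply: contraNneq k'0 => lk0; rewrite -x0P -xE csym.
  by apply: connect_trans xl _; rewrite lk0 csym x0P.
have [kxk'|kxk'] := eqVneq kx k'.
  by rewrite kxk' xE partnerK -xE csym xE x0P (negPf k'0).
rewrite {2}xE (@partner_comp _ _ _ k0) => [/conn0|]; first by rewrite eqxx.
by rewrite /= !inE negb_or kx0 kxk' k'0.
Qed.

Lemma upd_subrel t e k : 
  (forall x, x.1.1 = e -> connect (dihedral corner (cut t e)) x (partner k x)) ->
  subrel (connect (circle_arc (upd t e k))) (connect (dihedral corner (cut t e))).
Proof.
move=> ck; apply: connect_sub => x y /orP[/eqP->|/eqP->].
  by apply: connect1; rewrite /dihedral eqxx.
rewrite /smooth ffunE; case: eqVneq => [/ck//|xe].
by apply: connect1; rewrite /dihedral /cut (negPf xe) eqxx orbT.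
Qed.

(** Closing up by the [k0] of [cut_pairing] leaves two separate circles at [e]. Each of the other
    two pairings merges the paths into one circle through all four corners, so both produce the same
    classes of flags. *)
Lemma tight_pairings t e : exists k0, basis (upd t e k0) = false /\
  forall k k', k != k0 -> k' != k0 -> basis (upd t e k) = basis (upd t e k').
Proof.
have [k0 k0P] := cut_pairing t e; exists k0; split.
  apply/negP=> /basisP b.
  have [k kk0] : exists k, k != k0.
    by case: (k0) => [[]|]; [exists None | exists None | exists by_along].
  have := k0P (e, false, false) k erefl; rewrite (negPf kk0) => /negP[].
  by apply: (@upd_subrel _ _ k0) => [x xe|]; rewrite ?k0P //; apply: b; rewrite partner_edge.
have all_conn k x y : k != k0 -> x.1.1 = e -> y.1.1 = e ->
    connect (circle_arc (upd t e k)) x y.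
  move=> kk0.
  have step0 z : z.1.1 = e -> connect (circle_arc (upd t e k)) z (partner k0 z).
    by move=> ze; apply: cut_subrel; rewrite k0P.
  have stepk z : z.1.1 = e -> connect (circle_arc (upd t e k)) z (partner k z).
    by move=> ze; apply: connect1; rewrite /circle_arc /dihedral /smooth ffunE ze eqxx eqxx orbT.
  have [l ukl] := third_pairing kk0.
  move=> xe ye; have [<-|[m ->]] : x = y \/ exists m, y = partner m x.
  - by apply: same_edgeP; rewrite xe.
  - exact: connect0.
  have [->|mk] := eqVneq m k; first exact: stepk.
  have [->|mk0] := eqVneq m k0; first exact: step0.
  (* The third corner is reached by following the cut path, which realizes [k0], and then the arc
     [k]. *)
  rewrite -(@partner_comp _ k k0 m).
    by apply: connect_trans (step0 x xe) _; apply: stepk; rewrite partner_edge.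
  by rewrite /= !inE negb_or kk0 ![_ == m]eq_sym mk mk0.
have sub k k' : k != k0 -> k' != k0 ->
    subrel (connect (circle_arc (upd t e k))) (connect (circle_arc (upd t e k'))).
  move=> kk0 kk0'; apply: connect_sub => x y /orP[/eqP->|/eqP->].
    by apply: connect1; rewrite /circle_arc /dihedral eqxx.
  case: (eqVneq x.1.1 e) => [xe|xe].
    by apply: all_conn; rewrite ?partner_edge.
  apply: connect1; rewrite /circle_arc /dihedral /smooth !ffunE (negPf xe).
  by rewrite eqxx orbT.
move=> k k' kk0 kk0'.
by apply/basisP/basisP=> b x y /b; apply: sub.
Qed.

(** One of the three pairings is the [k0] of [tight_pairings], with value false, and the other two
    values agree. So the three values sum to zero modulo 2, a form symmetric in the pairings. *)
Lemma basis_tight t e a b c : uniq [:: a; b; c] ->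
  basis (upd t e a) (+) basis (upd t e b) = basis (upd t e c).
Proof.
have [k0 [bk0 same]] := tight_pairings t e; rewrite /= !inE andbT negb_or.
case/andP=> /andP[ab ac] bc.
have [ak|ak] := eqVneq a k0; first by rewrite ak bk0; apply: same; rewrite -ak eq_sym.
have [bk|bk] := eqVneq b k0.
  by rewrite bk bk0 addbF; apply: same; rewrite // -bk eq_sym.
have ck : c = k0 by case: a b c k0 ab ac bc ak bk {bk0 same} => [[]|] [[]|] [[]|] [[]|].
by rewrite ck bk0 (same a b) // addbb.
Qed.

End Circles.

(** * The group action as a change of frames *)

Section Orbit.
Variables (E : finType) (n : nat) (B : {ffun E -> pairing} -> bool).
Hypothesis B_tight : forall t e a b c, uniq [:: a; b; c] ->
  B (upd t e a) (+) B (upd t e b) = B (upd t e c).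

(* The pairings at one edge that belong to T_1, T_2 and T_3. *)
Definition frame := (pairing * pairing * pairing)%type.
Implicit Types (q : E -> frame) (sigma : E -> 'I_n) (r : frame) (w : word).

Definition frame_uniq r := uniq [:: r.1.1; r.1.2; r.2].

Definition select q sigma (F : {set 'I_n}) : {ffun E -> pairing} :=
  [ffun e => if sigma e \in F then (q e).1.2 else (q e).1.1].

Definition framed_system q sigma : setsystem n :=
  [set F | B (select q sigma F)].

Definition generator_frame (g : generator) r : frame :=
  let: (a, b, c) := r in
  match g with Star => (b, a, c) | Plus => (a, c, b) end.

Definition word_frame w r : frame := foldr generator_frame r w.

Lemma generator_frame_uniq g r : frame_uniq r -> frame_uniq (generator_frame g r).
Proof.
by case: r g => [[[[]|] [[]|]] [[]|]] [].
Qed.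

Lemma word_frame_uniq w r : frame_uniq r -> frame_uniq (word_frame w r).
Proof. by move=> ur; elim: w => //= g w; apply: generator_frame_uniq. Qed.

Lemma mem_frame r k : frame_uniq r -> k \in [:: r.1.1; r.1.2; r.2].
Proof. by case: r k => [[[[]|] [[]|]] [[]|]] [[]|]. Qed.

(** The two adjacent transpositions generate all permutations of three places; the six cases list a
    word for each. *)
Lemma word_frame_trans r r' : frame_uniq r -> frame_uniq r' ->
  exists w, word_frame w r = r'.
Proof.
move: r r' => [[a b] c] [[a' b'] c'].
move=> u u'; have := mem_frame a' u; have := mem_frame b' u; have := mem_frame c' u.
move: u u'; rewrite /frame_uniq /= !inE !negb_or !andbT.
case/andP=> /andP[ab ac] bc /andP[/andP[ab' ac'] bc'].
case/or3P=> /eqP ec; case/or3P=> /eqP eb; case/or3P=> /eqP ea; subst;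
  rewrite ?eqxx // in ab' ac' bc' *.
- by exists [:: Star; Plus; Star].
- by exists [:: Plus; Star].
- by exists [:: Star; Plus].
- by exists [:: Plus].
- by exists [:: Star].
by exists [::].
Qed.

Lemma framed_system_ext q q' sigma sigma' : q =1 q' -> sigma =1 sigma' ->
  framed_system q sigma = framed_system q' sigma'.
Proof.
move=> qq' ss'; apply/setP=> F; rewrite !inE; congr B.
by apply/ffunP=> e; rewrite !ffunE qq' ss'.
Qed.

(** For [Star], toggling [sigma e0] in [F] exchanges the first two pairings at [e0]. For [Plus],
    nothing changes when [sigma e0] is outside [F]; otherwise the values for the first two pairings
    are added, which by [B_tight] is the value for the third. *)
Lemma generator_framed_system g q sigma e0 : injective sigma ->
  (forall e, frame_uniq (q e)) ->
  generator_act g (framed_system q sigma) (sigma e0) =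
  framed_system (fun e => if e == e0 then generator_frame g (q e) else q e) sigma.
Proof.
move=> inj_s uq; apply/setP=> F.
have uq0 := uq e0.
case: g => /=.
  rewrite in_partial_dual !inE; congr B; apply/ffunP=> e; rewrite !ffunE.
  rewrite in_symdiff inE (inj_eq inj_s); case: eqVneq => [->|_]; last by rewrite addbF.
  by case: (q e0) => [[a b] c] /=; case: (_ \in F).
rewrite in_loop_compl !inE; case: (boolP (sigma e0 \in F)) => [eF|eF]; last first.
  rewrite addbF; congr B; apply/ffunP=> e; rewrite !ffunE.
  case: eqVneq => [->|//]; rewrite (negPf eF).
  by case: (q e0) => [[a b] c].
set t := select q sigma F.
have tE : t = upd t e0 (q e0).1.2.
  by apply/ffunP=> e; rewrite !ffunE; case: eqVneq => // ->; rewrite eF.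
have -> : select q sigma (symdiff F [set sigma e0]) = upd t e0 (q e0).1.1.
  apply/ffunP=> e; rewrite !ffunE in_symdiff inE (inj_eq inj_s).
  by case: eqVneq => [->|_]; rewrite ?addbF ?eF.
rewrite andTb {1}tE addbC (B_tight _ _ uq0); congr B; apply/ffunP=> e; rewrite !ffunE.
case: eqVneq => [->|//]; rewrite eF.
by case: (q e0) => [[a b] c].
Qed.

Lemma word_framed_system w q sigma e0 : injective sigma ->
  (forall e, frame_uniq (q e)) ->
  word_act w (framed_system q sigma) (sigma e0) =
  framed_system (fun e => if e == e0 then word_frame w (q e) else q e) sigma.
Proof.
move=> inj_s uq; elim: w => [|g w IHw] /=.
  by apply: framed_system_ext => // e; case: eqP.
rewrite IHw generator_framed_system //; last first.
  by move=> e; case: eqP => // _; apply: word_frame_uniq.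
by apply: framed_system_ext => // e; case: eqP.
Qed.

Lemma hat_framed_system (gh : 'I_n -> word) q sigma : bijective sigma ->
  (forall e, frame_uniq (q e)) ->
  hat_act gh (framed_system q sigma) =
  framed_system (fun e => word_frame (gh (sigma e)) (q e)) sigma.
Proof.
move=> bij_s uq; have inj_s := bij_inj bij_s; have [nu nuK sK] := bij_s.
rewrite /hat_act; have := enum_uniq 'I_n; move: (mem_enum 'I_n).
move: (enum 'I_n) => s s_all us.
(* The induction runs over a list [s] without repetitions: only the edges numbered in [s] have
   received their new frame so far. *)
rewrite (_ : foldr _ _ s = framed_system (fun e =>
  if sigma e \in s then word_frame (gh (sigma e)) (q e) else q e) sigma).
  by apply: framed_system_ext => // e; rewrite s_all.
elim: s us {s_all} => [|i s IHs] //= /andP[i_s us].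
rewrite IHs // -[i in word_act _ _ i]sK word_framed_system //; last first.
  by move=> e; case: ifP => // _; apply: word_frame_uniq.
apply: framed_system_ext => // e; rewrite inE (can2_eq nuK sK).
by case: eqVneq => [->|//]; rewrite sK (negPf i_s).
Qed.

Lemma relabel_framed_system q sigma (p : 'S_n) :
  relabel (framed_system q sigma) p = framed_system q (p \o sigma).
Proof.
apply/setP=> F; rewrite inE; apply/imsetP/idP=> [[I /[!inE] BI ->]|BF].
  rewrite (_ : select _ _ _ = select q sigma I) //; apply/ffunP=> e; rewrite !ffunE /=.
  by rewrite mem_imset //; apply: perm_inj.
exists (p @^-1: F).
  rewrite inE (_ : select _ _ _ = select q (p \o sigma) F) //.
  by apply/ffunP=> e; rewrite !ffunE inE.
apply/setP=> i; apply/idP/imsetP=> [iF|[j /[!inE] jF ->//]].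
by exists (p^-1 i)%g; rewrite ?inE permKV.
Qed.

(** Words reach every frame at each edge independently, and permutations reach every numbering, so
    the orbit runs over all choices of both. *)
Lemma Orb_framed_system q sigma D' : bijective sigma ->
  (forall e, frame_uniq (q e)) ->
  Orb (framed_system q sigma) D' <->
  exists q' sigma', [/\ forall e, frame_uniq (q' e), bijective sigma' &
    D' = framed_system q' sigma'].
Proof.
move=> bij_s uq; have [nu sK nuK] := bij_s; split.
  case=> -[gh p] ->; rewrite /semidirect_act /= relabel_framed_system.
  have bij_ps : bijective (p \o sigma).
    by apply: bij_comp => //; apply: injF_bij; apply: perm_inj.
  exists (fun e => word_frame (gh (p (sigma e))) (q e)), (p \o sigma).
  by split=> [e||]; [apply: word_frame_uniq | | rewrite hat_framed_system].
case=> q' [sigma' [uq' bij_s' ->]]; have [nu' sK' nuK'] := bij_s'.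
have inj_p : injective (sigma' \o nu) by apply: inj_comp (can_inj sK') (can_inj nuK).
have [w wP] : exists w : E -> word, forall e, word_frame (w e) (q e) = q' e.
  by apply: (fin_all_exists (P := fun e w => word_frame w (q e) = q' e)) => e;
    apply: word_frame_trans.
(* The words act after the relabelling, so the word of an edge sits at its new number, whence [nu'].
   The permutation is [sigma'] after the inverse of [sigma]. *)
exists (fun i => w (nu' i), perm inj_p); rewrite /semidirect_act /=.
have psE : perm inj_p \o sigma =1 sigma' by move=> e; rewrite /= permE /= sK.
rewrite relabel_framed_system hat_framed_system //; last exact: eq_bij bij_s' _ (fsym psE).
by apply: framed_system_ext => // e; have /= -> := psE e; rewrite sK'.
Qed.

End Orbit.

(** * Spanning quasi-trees as bases *)

Section QuasiTrees.
Variables (V E : finType) (G : ribbon_graph V E).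
Notation vert := (rg_vert G).
Notation corner := (rg_corner G).
Implicit Types (x y : flag E) (A : {set E}) (t : {ffun E -> pairing}).

(** Connectivity of the medial graph, expressed on half-edges: [corner] follows a medial edge, and
    flags of the same edge of [G] meet at one medial vertex. *)
Definition medial_arc : rel (flag E) :=
  fun x y => (y == corner x) || (y.1.1 == x.1.1).

Lemma medial_arc_sym : connect_sym medial_arc.
Proof.
apply: sym_connect_sym => x y; rewrite /medial_arc [y == _]eq_sym.
by rewrite (can2_eq (rg_cornerK G) (rg_cornerK G)) [_.1.1 == _]eq_sym.
Qed.

Lemma circle_arc_medial t : subrel (connect (circle_arc G t)) (connect medial_arc).
Proof.
apply: connect_sub => x y /orP[/eqP->|/eqP->]; apply: connect1;
  rewrite /medial_arc ?eqxx //.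
by rewrite /smooth partner_edge eqxx orbT.
Qed.

Lemma basis_connect t : basis G t =
  [forall x, forall y, connect medial_arc x y ==> connect (circle_arc G t) x y].
Proof.
apply/basisP/forallP=> [b x|b x y xy]; last first.
  have /forallP/(_ y)/implyP := b x; apply; apply: connect1.
  by rewrite /medial_arc xy eqxx orbT.
apply/forallP=> y; apply/implyP; apply: connect_sub => {}x {}y /orP[/eqP->|/eqP/esym/b//].
by apply: connect1; rewrite /circle_arc /dihedral eqxx.
Qed.

Definition quasi_tree_pairing A : {ffun E -> pairing} :=
  [ffun e => if e \in A then by_along else by_across].

Lemma boundary_arcE A : boundary_arc G A =2 circle_arc G (quasi_tree_pairing A).
Proof.
move=> x y; rewrite /boundary_arc /circle_arc /dihedral /smooth ffunE.
by case: (x.1.1 \in A); rewrite ?partner_across ?partner_along.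
Qed.

Lemma boundary_arc_connect A :
  connect (boundary_arc G A) =2 connect (circle_arc G (quasi_tree_pairing A)).
Proof. exact/eq_connect/boundary_arcE. Qed.

Lemma boundary_arc_sym A : connect_sym (boundary_arc G A).
Proof. by move=> x y; rewrite !boundary_arc_connect; apply: circle_arc_sym. Qed.

Lemma vert_across x : vert (across x) = vert x.
Proof.
by apply/esym/eqP; rewrite rg_vertP; apply: connect1; rewrite eqxx orbT.
Qed.

Lemma vert_corner x : vert (corner x) = vert x.
Proof. by apply/esym/eqP; rewrite rg_vertP; apply: connect1; rewrite eqxx. Qed.

Lemma alongK : involutive (@along E).
Proof. by move=> [[e h] s] /=; rewrite negbK. Qed.

Lemma along_edge x : (along x).1.1 = x.1.1.
Proof. by case: x => [[]]. Qed.

Lemma across_edge x : (across x).1.1 = x.1.1.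
Proof. by case: x => [[]]. Qed.

Lemma rg_adj_sym A : connect_sym (rg_adj G A).
Proof.
apply: sym_connect_sym => v w; apply/existsP/existsP=> -[x /and3P[xA xv xw]];
  by exists (along x); rewrite along_edge alongK xA xv xw.
Qed.

Lemma rg_adj_along A x : x.1.1 \in A -> rg_adj G A (vert x) (vert (along x)).
Proof. by move=> xA; apply/existsP; exists x; rewrite xA !eqxx. Qed.

(** A boundary circle changes vertex only by running along an edge of [A]. *)
Lemma boundary_arc_vert A x y :
  connect (boundary_arc G A) x y -> connect (rg_adj G A) (vert x) (vert y).
Proof.
have cl : closed (boundary_arc G A) [pred y | connect (rg_adj G A) (vert x) (vert y)].
  apply: (intro_closed (@boundary_arc_sym A)) => {}y z; rewrite !inE.
  case/orP=> /eqP->; first by rewrite vert_corner.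
  case: ifP => [yA xy|_]; last by rewrite vert_across.
  exact: connect_trans xy (connect1 (rg_adj_along yA)).
by move=> /(closed_connect cl); rewrite !inE connect0 => /esym.
Qed.

Lemma same_vert_medial x y : vert x = vert y -> connect medial_arc x y.
Proof.
move=> /eqP; rewrite rg_vertP; apply: connect_sub => {}x {}y /orP[]/eqP->;
  by apply: connect1; rewrite /medial_arc ?across_edge eqxx ?orbT.
Qed.

Lemma rg_adj_medial A v w x y : connect (rg_adj G A) v w ->
  vert x = v -> vert y = w -> connect medial_arc x y.
Proof.
case/connectP=> p; elim: p v x => [|u p IHp] v x /=.
  by move=> _ -> <- xy; apply: same_vert_medial.
case/andP=> /existsP[z /and3P[_ /eqP zv /eqP zu]] pth lst xv yw.
apply: connect_trans (IHp u (along z) pth lst zu yw).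
apply: (@connect_trans _ _ z); first by apply: same_vert_medial; rewrite xv.
by apply: connect1; rewrite /medial_arc along_edge eqxx orbT.
Qed.

(** With [rg_adj_medial] this matches the components of the medial graph on flags with the
    components of [G] that carry an edge. *)
Lemma medial_vert x y :
  connect medial_arc x y -> connect (rg_adj G setT) (vert x) (vert y).
Proof.
have cl : closed medial_arc [pred y | connect (rg_adj G setT) (vert x) (vert y)].
  apply: (intro_closed medial_arc_sym) => {}y z; rewrite !inE.
  case/orP=> [/eqP->|/eqP/esym yz]; first by rewrite vert_corner.
  move=> xy; have step u : connect (rg_adj G setT) (vert u) (vert (along u)).
    by apply: connect1; apply: rg_adj_along; rewrite inE.
  case: (same_edgeP yz) => [<- //|[k ->]]; apply: (connect_trans xy).
  case: k => [[]|]; first by rewrite partner_along.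
    by rewrite (partner_across y) vert_across.
  have <- : across (along y) = partner crossing y.
    by case: y {xy yz} => [[e h] s] /=; rewrite !addbT.
  by rewrite vert_across.
by move=> /(closed_connect cl); rewrite !inE connect0 => /esym.
Qed.

Lemma isolated_comp A v w : v \in isolated_vertices G ->
  connect (rg_adj G A) v w -> w = v.
Proof.
rewrite inE => iv /connectP[[|u p] //= /andP[/existsP[x /and3P[_ /eqP xv _]] _]].
by rewrite -xv codom_f in iv.
Qed.

(** One boundary circle per component puts all flags of a component of [G] on a common circle.
    Conversely, in a basis the corners of each edge share a boundary circle, which stays inside one
    component of [(V, A)]; hence [(V, A)] has the components of [G]. *)
Lemma spanning_quasi_tree_basis A :
  spanning_quasi_tree G A = basis G (quasi_tree_pairing A).
Proof.
have symb := @boundary_arc_sym A.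
have subA v w : connect (rg_adj G A) v w -> connect (rg_adj G setT) v w.
  apply: connect_sub => {}v {}w /existsP[x /and3P[_ xv xw]].
  by apply: connect1; apply/existsP; exists x; rewrite inE xv xw.
rewrite basis_connect; apply/andP/forallP=> [[_ /forallP qt] x|b].
  apply/forallP=> y; apply/implyP=> xy; rewrite -boundary_arc_connect.
  have /andP[/eqP comp /eqP nb] := qt (vert x).
  have clC : closed (boundary_arc G A) [pred y | vert y \in rg_comp G A (vert x)].
    apply: (intro_closed symb) => z w zw; rewrite !inE => /connect_trans; apply.
    by apply: boundary_arc_vert; apply: connect1.
  have xC : vert x \in rg_comp G A (vert x) by rewrite inE connect0.
  have yC : vert y \in rg_comp G A (vert x) by rewrite comp inE medial_vert.
  (* The circle through [x] already accounts for the whole count of one, leaving nothing for the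
     isolated vertices. *)
  have n0 : 0 < n_comp (boundary_arc G A) [pred y | vert y \in rg_comp G A (vert x)].
    apply/card_gt0P; exists (root (boundary_arc G A) x).
    rewrite !inE roots_root //=.
    by have := closed_connect clC (connect_root _ x); rewrite !inE connect0 => <-.
  apply: (n_comp1_connect symb clC) => //.
  by apply/eqP; rewrite eqn_leq n0 -nb leq_addr.
have conn x y : connect medial_arc x y -> connect (boundary_arc G A) x y.
  by move=> xy; rewrite boundary_arc_connect; have /forallP/(_ y)/implyP := b x; apply.
have eqA : connect (rg_adj G A) =2 connect (rg_adj G setT).
  move=> v w; apply/idP/idP; first exact: subA.
  apply: connect_sub => {}v {}w /existsP[x /and3P[_ /eqP<- /eqP<-]].
  apply/boundary_arc_vert/conn/connect1.
  by rewrite /medial_arc along_edge eqxx orbT.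
split; first by apply/eqP; apply: eq_n_comp.
apply/forallP=> v; apply/andP; split.
  by apply/eqP/setP=> w; rewrite !inE eqA.
(* The component of an isolated vertex has no flags and is counted by the second summand alone; any
   other component contains no isolated vertex, so that summand vanishes. *)
rewrite /nboundary; have [iv|] := boolP (v \in isolated_vertices G).
  have compE w : (w \in rg_comp G A v) = (w == v).
    rewrite inE; apply/idP/eqP=> [/(isolated_comp iv)//|->]; exact: connect0.
  rewrite (_ : _ :&: _ = [set v]) ?cards1; last first.
    by apply/setP=> w; rewrite !in_setI compE in_set1; case: eqP => // ->.
  rewrite (eq_n_comp_r (a' := pred0)).
    by rewrite /n_comp_mem eq_card0 // => x; rewrite !inE andbF.
  move=> x; rewrite [LHS]compE; apply: contraTF iv => /eqP <-.
  by rewrite inE negbK codom_f.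
rewrite inE negbK => /codomP[x ->].
rewrite (_ : _ :&: _ = set0) ?cards0 ?addn0; last first.
  apply/setP=> w; rewrite !in_setI in_set0; apply/andP=> -[].
  rewrite inE rg_adj_sym => xw iw; have xE := isolated_comp iw xw.
  by move: iw; rewrite -xE inE codom_f.
rewrite -(n_comp_connect symb x); apply/eqP/eq_n_comp_r => y; rewrite !inE.
apply/idP/idP=> [xy|]; last exact: boundary_arc_vert.
by apply: conn; apply: rg_adj_medial xy _ _.
Qed.

Lemma delta_matroid_framed (n : nat) (o : E -> 'I_n) :
  delta_matroid G o =
  framed_system (basis G) (fun=> (by_across, by_along, crossing)) o.
Proof.
apply/setP=> F; rewrite !inE spanning_quasi_tree_basis; congr (basis G _).
by apply/ffunP=> e; rewrite !ffunE inE.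
Qed.

End QuasiTrees.

(** * Components counted on blocks and on half-edges *)

Section Components.
Variables (H : finType) (m : H -> H) (blk : H -> {set H}) (l : nat).
Hypotheses (mK : involutive m) (blk_refl : forall x, x \in blk x)
  (blk_eq : forall x y, y \in blk x -> blk y = blk x).

Definition block_arc : rel H := fun x y => (y == m x) || (y \in blk x).

Lemma mem_blkC x y : (y \in blk x) = (x \in blk y).
Proof. by apply/idP/idP=> /blk_eq ->; apply: blk_refl. Qed.

Lemma block_arc_sym : connect_sym block_arc.
Proof.
apply: sym_connect_sym => x y.
by rewrite /block_arc mem_blkC eq_sym (can2_eq mK mK).
Qed.

(** Sending a half-edge to its block is an adjunction between the two relations, and adjunctions
    preserve the number of components. *)
Lemma ncomponents_blocks :
  ncomponents m [set blk x | x in [set: H]] l = n_comp block_arc H + l.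
Proof.
rewrite /ncomponents; congr (_ + l); set P := [set blk x | x in _].
pose e : rel {set H} := fun B C => [&& B \in P, C \in P & [exists h in B, m h \in C]].
have blkP x : blk x \in P by apply: imset_f; rewrite inE.
have sym_e : connect_sym e.
  apply: sym_connect_sym => B C; rewrite /e andbCA; congr [&& _, _ & _].
  apply/existsP/existsP=> -[h /andP[hB mhC]]; exists (m h); by rewrite mhC mK.
have cl_P : closed e P by move=> B C /and3P[-> ->].
rewrite (@adjunction_n_comp _ _ blk e block_arc sym_e block_arc_sym P cl_P).
  by apply: eq_n_comp_r => x; rewrite !inE blkP.
apply: RelAdjunction => [B /imsetP/sig2_eqW[x _ ->]|x y _].
  by exists x; apply: connect0.
apply/idP/idP.
  case/connectP=> p; elim: p x => [|z p IHp] x /=; first by move=> _ ->; apply: connect0.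
  case/andP=> xz pth lst; apply: connect_trans (IHp z pth lst).
  case/orP: xz => [/eqP->|/blk_eq->]; last exact: connect0.
  by apply: connect1; rewrite /e !blkP; apply/existsP; exists x; rewrite !blk_refl.
have same u v : v \in blk u -> connect block_arc u v.
  by move=> uv; apply: connect1; rewrite /block_arc uv orbT.
case/connectP=> p; elim: p x => [|B p IHp] x /=.
  by move=> _ xy; apply: same; rewrite -xy blk_refl.
case/andP=> /and3P[_ /imsetP[z _ ->] /existsP[h /andP[hx mhz]]] pth lst.
apply: connect_trans (IHp z pth lst); apply: connect_trans (same _ _ hx) _.
apply: (@connect_trans _ _ (m h)); first by apply: connect1; rewrite /block_arc eqxx.
by apply: same; rewrite mem_blkC.
Qed.
End Components.

(** * Transitions and transversals of the medial graph *)

Section MedialTransitions.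
Variables (V E : finType) (G : ribbon_graph V E).
Notation F := (medial_graph G).
Implicit Types (x y : flag E) (e : E) (k : pairing) (t : {ffun E -> pairing}).

Definition corners e : {set flag E} := [set x | x.1.1 == e].

Definition pairs e k : {set {set flag E}} := [set [set x; partner k x] | x in corners e].

Lemma pair_eq k x y : y \in [set x; partner k x] ->
  [set y; partner k y] = [set x; partner k x].
Proof. by rewrite !inE => /orP[]/eqP-> //; rewrite partnerK setUC. Qed.

Lemma pairs_partition e k : partition (pairs e k) (corners e).
Proof.
apply/and3P; split.
- apply/eqP/setP=> x; apply/bigcupP/idP=> [[B /imsetP[y ye ->]]|xe].
    by move: ye; rewrite !inE => ye /orP[]/eqP->; rewrite ?partner_edge.
  by exists [set x; partner k x]; [apply: imset_f | rewrite !inE eqxx].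
- apply/trivIsetP=> _ _ /imsetP[x _ ->] /imsetP[y _ ->]; apply: contraR.
  by case/pred0Pn=> z /andP[/= /pair_eq <- /pair_eq <-].
by apply/imsetP=> -[x _ /setP/(_ x)]; rewrite !inE eqxx.
Qed.

Lemma pairs_transition e k : transition_at (F := F) (corners e) (pairs e k).
Proof.
rewrite /transition_at pairs_partition; apply/forallP=> B; apply/implyP=> /imsetP[x _ ->].
by rewrite cards2 [x == _]eq_sym partner_neq.
Qed.

(** The block of the corner [x0] determines [k]. For [k' != k], one of [x] and [partner k' x] lies
    in that block, so a block pairing [x] by [k'] would coincide with it, forcing [k' = k]. *)
Lemma transition_pairs e (p : {set {set flag E}}) :
  transition_at (F := F) (corners e) p -> exists k, p = pairs e k.
Proof.
case/andP=> part /forallP p2; have [/eqP cov triv p0] := and3P part.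
have blockE x : x.1.1 = e -> exists k, pblock p x = [set x; partner k x].
  move=> xe; have xp : x \in cover p by rewrite cov inE xe.
  have /implyP/(_ (pblock_mem xp)) := p2 (pblock p x).
  have xx : x \in pblock p x by rewrite mem_pblock.
  rewrite (cardsD1 x) xx => /cards1P[y yE].
  have /setD1P[yx yB] : y \in pblock p x :\ x by rewrite yE set11.
  have ye : y.1.1 = e.
    have : y \in corners e by rewrite -cov; apply/bigcupP;
      exists (pblock p x); rewrite ?pblock_mem.
    by rewrite inE => /eqP.
  have [xy|[k yk]] : x = y \/ exists k, y = partner k x.
  - by apply: same_edgeP; rewrite ye.
  - by rewrite xy eqxx in yx.
  by exists k; rewrite -yk -(setD1K xx) yE.
pose x0 : flag E := (e, false, false).
have [k kP] := blockE x0 erefl; exists k.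
have cov_mem x : x.1.1 = e -> x \in cover p by move=> xe; rewrite cov inE xe.
have blocks x : x.1.1 = e -> pblock p x = [set x; partner k x].
  move=> xe; have [k' k'P] := blockE x xe.
  have [<-//|k'k] := eqVneq k' k.
  have disj y : y \in pblock p x0 -> y \in pblock p x -> k' = k.
    move=> yx0 yx; have px : pblock p x = pblock p x0.
      by rewrite -(same_pblock triv yx) (same_pblock triv yx0).
    have : x \in pblock p x0 by rewrite -px mem_pblock cov_mem.
    rewrite kP => /pair_eq; rewrite -kP -px k'P => /setP/(_ (partner k' x)).
    by rewrite !inE eqxx orbT (negPf (partner_neq _ _)) => /eqP/partner_inj.
  have [x0x|[l xl]] : x0 = x \/ exists l, x = partner l x0.
  - by apply: same_edgeP; rewrite xe.
  - by rewrite -x0x.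
  suff : k' = k by move=> k'kE; rewrite k'kE eqxx in k'k.
  have [lk|lk] := eqVneq l k.
    by apply: (disj x); rewrite ?kP ?k'P xl lk !inE eqxx ?orbT.
  apply: (disj (partner k' x)); last by rewrite k'P !inE eqxx orbT.
  have [->|k'l] := eqVneq k' l; first by rewrite xl partnerK kP !inE eqxx.
  by rewrite xl (@partner_comp _ _ _ k) ?kP /= !inE ?eqxx ?orbT // negb_or k'l k'k lk.
apply/setP=> B; apply/idP/imsetP=> [Bp|[x]].
  have [x xB] : exists x, x \in B by apply/set0Pn; apply: contraNneq p0 => <-.
  have xe : x \in corners e by rewrite -cov; apply/bigcupP; exists B.
  exists x => //; rewrite -blocks; last by move: xe; rewrite inE => /eqP.
  by rewrite (def_pblock triv Bp xB).
by rewrite inE => /eqP xe ->; rewrite -blocks // pblock_mem ?cov_mem.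
Qed.

Lemma pairs_inj e e' k k' : pairs e k = pairs e' k' -> e = e' /\ k = k'.
Proof.
move=> eq_p; have ee' : e = e'.
  have := cover_partition (pairs_partition e k).
  rewrite eq_p (cover_partition (pairs_partition e' k')).
  by move/setP/(_ (e, false, false)); rewrite !inE eqxx => /eqP.
split=> //; pose x : flag E := (e, false, false).
have : [set x; partner k x] \in pairs e' k' by rewrite -eq_p; apply/imsetP;
  exists x; rewrite ?inE.
case/imsetP=> y _ xy.
have : x \in [set y; partner k' y] by rewrite -xy set21.
move/pair_eq; rewrite -xy => /setP/(_ (partner k x)).
by rewrite !inE eqxx orbT (negPf (partner_neq _ _)) => /eqP/partner_inj.
Qed.

Lemma corners_vertex e : corners e \in vertices F.
Proof. exact: imset_f. Qed.

Lemma pairs_subproof e k :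
  [exists v in vertices F, transition_at v (pairs e k)].
Proof.
by apply/existsP; exists (corners e); rewrite corners_vertex; apply: pairs_transition.
Qed.

(** By [tr_inj] and [tr_surj] these are coordinates on [U], identifying it with pairs of an edge and
    a pairing. *)
Definition tr e k : transition F := exist _ (pairs e k) (pairs_subproof e k).

Lemma tr_inj e e' k k' : tr e k = tr e' k' -> e = e' /\ k = k'.
Proof. by move/(congr1 val); apply: pairs_inj. Qed.

Lemma tr_surj (u : transition F) : exists e k, u = tr e k.
Proof.
case: u => p up; have /existsP[v /andP[/imsetP[e _ vE] vp]] := up.
have [k pE] : exists k, p = pairs e k by apply: transition_pairs; rewrite /corners -vE.
by exists e, k; apply: val_inj.
Qed.

Definition tr_class e : {set transition F} := [set tr e k | k in [set: pairing]].

Lemma mem_tr_class e e' k : (tr e k \in tr_class e') = (e == e').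
Proof.
apply/imsetP/eqP=> [[k' _ /tr_inj[]//]|<-]; by exists k; rewrite ?inE.
Qed.

Lemma transition_classesE : transition_classes F = [set tr_class e | e in [set: E]].
Proof.
have classE e : [set u : transition F | transition_at (F := F) (corners e) (val u)]
    = tr_class e.
  apply/setP=> u; rewrite inE; apply/idP/imsetP=> [/transition_pairs[k uk]|[k _ ->]].
    by exists k; rewrite ?inE //; apply: val_inj.
  exact: pairs_transition.
apply/setP=> W; apply/imsetP/imsetP=> [[_ /imsetP[e _ ->] ->]|[e _ ->]].
  by exists e; rewrite ?inE // -classE.
by exists (corners e); rewrite ?corners_vertex // classE.
Qed.

Lemma transition_classes_partition : partition (transition_classes F) [set: transition F].
Proof.
rewrite transition_classesE; apply/and3P; split.
- apply/eqP/setP=> u; rewrite inE; have [e [k ->]] := tr_surj u.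
  by apply/bigcupP; exists (tr_class e); rewrite ?mem_tr_class ?imset_f ?inE.
- apply/trivIsetP=> _ _ /imsetP[e _ ->] /imsetP[e' _ ->]; apply: contraR.
  case/pred0Pn=> u; have [e0 [k ->]] := tr_surj u.
  by rewrite /= !mem_tr_class => /andP[/eqP<- /eqP<-].
by apply/imsetP=> -[e _ /setP/(_ (tr e None))]; rewrite mem_tr_class eqxx inE.
Qed.

Definition transversal_of t : {set transition F} := [set tr e (t e) | e in [set: E]].

Lemma mem_transversal_of t e k : (tr e k \in transversal_of t) = (k == t e).
Proof.
apply/imsetP/eqP=> [[e' _ /tr_inj[-> ->//]]|->]; by exists e; rewrite ?inE.
Qed.

Lemma medial_transversalP (T : {set transition F}) :
  reflect (exists t, T = transversal_of t)
    (is_transversal T (transition_classes F) [set: transition F]).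
Proof.
rewrite /is_transversal transition_classes_partition subsetT /=.
apply: (iffP forallP) => [T1|[t ->] W]; last first.
  apply/implyP; rewrite transition_classesE => /imsetP[e _ ->].
  apply/cards1P; exists (tr e (t e)); apply/setP=> u; have [e' [k ->]] := tr_surj u.
  rewrite !inE mem_transversal_of mem_tr_class.
  apply/andP/eqP=> [[/eqP-> /eqP->]//|/tr_inj[-> ->]]; by rewrite !eqxx.
have [t tP] : exists t : E -> pairing, forall e, T :&: tr_class e = [set tr e (t e)].
  apply: (fin_all_exists (P := fun e k => T :&: tr_class e = [set tr e k])) => e.
  have /implyP := T1 (tr_class e); rewrite transition_classesE imset_f ?inE //.
  case/(_ isT)/cards1P=> u uE; have [e' [k uk]] := tr_surj u.
  have : u \in T :&: tr_class e by rewrite uE set11.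
  by rewrite inE uk mem_tr_class => /andP[_ /eqP ee']; exists k; rewrite uE uk ee'.
exists (finfun t); apply/setP=> u; have [e [k ->]] := tr_surj u.
have /setP/(_ (tr e k)) := tP e; rewrite !inE mem_tr_class eqxx andbT => ->.
rewrite mem_transversal_of ffunE.
by apply/eqP/eqP=> [/tr_inj[]|->].
Qed.

End MedialTransitions.

(** * The 3-matroid of the medial graph and its set systems *)

Section MedialMatroid.
Variables (V E : finType) (G : ribbon_graph V E).
Notation F := (medial_graph G).
Notation tr := (tr G).
Notation transversal_of := (transversal_of G).
Implicit Types (x y : flag E) (e : E) (k : pairing) (t : {ffun E -> pairing}).

Lemma split_verticesE t : split_vertices (transversal_of t) =
  [set [set x; smooth t x] | x in [set: flag E]].
Proof.
apply/setP=> B; apply/bigcupP/imsetP=> [[_ /imsetP[e _ ->] /imsetP[x]]|[x _ ->]].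
  by rewrite inE => /eqP xe ->; exists x; rewrite ?inE // /smooth xe.
exists (tr x.1.1 (t x.1.1)); first by rewrite mem_transversal_of.
by apply/imsetP; exists x; rewrite ?inE.
Qed.

Lemma ncomponents_split t l :
  ncomponents (rg_corner G) (split_vertices (transversal_of t)) l =
  n_comp (circle_arc G t) {: flag E} + l.
Proof.
rewrite split_verticesE ncomponents_blocks; first last.
- by move=> x y; rewrite !inE => /orP[]/eqP-> //; rewrite smoothK setUC.
- by move=> x; rewrite set21.
- exact: rg_cornerK.
congr (_ + l); apply: eq_n_comp => x y; apply/idP/idP; apply: connect_sub => {}x {}y.
  case/orP=> [/eqP->|]; last (rewrite !inE => /orP[/eqP->|/eqP->]).
  - by apply: connect1; rewrite /circle_arc /dihedral eqxx.
  - exact: connect0.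
  by apply: connect1; rewrite /circle_arc /dihedral eqxx orbT.
by case/orP=> /eqP->; apply: connect1; rewrite /block_arc ?eqxx // set22 orbT.
Qed.

Lemma ncomponents_medial l :
  ncomponents (rg_corner G) (medial_vertices E) l = n_comp (medial_arc G) {: flag E} + l.
Proof.
have -> : medial_vertices E = [set corners x.1.1 | x in [set: flag E]].
  apply/setP=> B; apply/imsetP/imsetP=> [[e _ ->]|[x _ ->]]; last by exists x.1.1.
  by exists (e, false, false).
rewrite ncomponents_blocks; first last.
- by move=> x y; rewrite inE => /eqP->.
- by move=> x; rewrite inE.
- exact: rg_cornerK.
by congr (_ + l); apply: eq_n_comp; apply: eq_connect => x y; rewrite /block_arc inE.
Qed.

(** Smoothing refines the connectivity of the medial graph, so by [eq_connect_n_comp] equal counts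
    mean equal classes. The free loops contribute equally to both sides. *)
Lemma graph_basesE : graph_bases F = [set transversal_of t | t in [set t | basis G t]].
Proof.
have basesE t : (ncomponents mate (split_vertices (transversal_of t)) (free_loops F)
    == ncomponents mate (vertices F) (free_loops F)) = basis G t.
  rewrite ncomponents_split ncomponents_medial eqn_add2r basis_connect.
  apply: eq_connect_n_comp; first exact: circle_arc_sym.
    exact: medial_arc_sym.
  exact: circle_arc_medial.
apply/setP=> T; rewrite inE; apply/andP/imsetP=> [[/medial_transversalP[t ->]]|[t bt ->]].
  by rewrite basesE => bt; exists t; rewrite ?inE.
by split; [apply/medial_transversalP; exists t | rewrite basesE; rewrite inE in bt].
Qed.

Lemma transversal_of_sub t t' : transversal_of t \subset transversal_of t' -> t = t'.
Proof.
move/subsetP=> sub; apply/ffunP=> e; apply/eqP.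
by rewrite -(mem_transversal_of G) sub // mem_transversal_of.
Qed.

(** No transversal properly contains another, so the maximal independent sets are the bases that
    generate them. *)
Lemma bases_graph_3matroid :
  bases (graph_3matroid F) = [set transversal_of t | t in [set t | basis G t]].
Proof.
have indepE I : (I \in graph_3matroid F) = [exists B in graph_bases F, I \subset B].
  by rewrite inE.
apply/setP=> X; rewrite inE; apply/maxsetP/imsetP.
  rewrite indepE => -[/existsP[B /andP[BF XB]] maxX].
  have := BF; rewrite graph_basesE => /imsetP[t bt BE]; exists t => //.
  rewrite -BE; apply/esym/maxX => //.
  by rewrite indepE; apply/existsP; exists B; rewrite BF /=.
case=> t bt ->; split=> [|Y].
  rewrite indepE; apply/existsP; exists (transversal_of t).
  by rewrite subxx andbT graph_basesE imset_f.
rewrite indepE => /existsP[B /andP[]]; rewrite graph_basesE => /imsetP[t' _ ->] YB tY.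
apply/eqP; rewrite eqEsubset tY andbT.
by rewrite (transversal_of_sub (subset_trans tY YB)).
Qed.

Definition frame_transversals (q : E -> frame) :
    {set transition F} * {set transition F} * {set transition F} :=
  (transversal_of [ffun e => (q e).1.1], transversal_of [ffun e => (q e).1.2],
   transversal_of [ffun e => (q e).2]).

(** Disjointness says that the three pairings chosen at each edge differ; being three, they exhaust
    the transitions there. *)
Lemma transversal_3tupleP tau :
  transversal_3tuple (transition_classes F) tau <->
  exists2 q, forall e, frame_uniq (q e) & tau = frame_transversals q.
Proof.
case: tau => [[T1 T2] T3]; split.
  case=> -[/medial_transversalP[t1 ->] /medial_transversalP[t2 ->] /medial_transversalP[t3 ->]].
  case=> d12 d13 d23 _; exists (fun e => (t1 e, t2 e, t3 e)) => [e|]; last first.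
    by congr (transversal_of _, transversal_of _, transversal_of _);
      apply/ffunP=> e; rewrite ffunE.
  have neq t t' : [disjoint transversal_of t & transversal_of t'] -> t e != t' e.
    move=> d; have := disjointFr d (x := tr e (t e)).
    by rewrite !mem_transversal_of => ->.
  by rewrite /frame_uniq /= !inE negb_or !neq.
case=> q uq [-> -> ->]; split.
- by split; apply/medial_transversalP; eexists.
- have disj t t' : (forall e, t e != t' e) -> [disjoint transversal_of t & transversal_of t'].
    move=> tt'; rewrite disjoint_subset; apply/subsetP=> u.
    have [e [k ->]] := tr_surj u.
    by rewrite inE !mem_transversal_of => /eqP->.
  by split; apply: disj => e; rewrite !ffunE; move: (uq e);
    rewrite /frame_uniq /= !inE negb_or => /andP[/andP[? ?] /andP[]].
apply/setP=> u; have [e [k ->]] := tr_surj u.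
have := mem_frame k (uq e); rewrite !inE !mem_transversal_of !ffunE.
by case/or3P=> ->; rewrite ?orbT.
Qed.

(** The classes correspond to the edges, so a projection amounts to a numbering of the edges. *)
Lemma projectionP (n : nat) (sigma : transition F -> 'I_n) : #|E| = n ->
  projection (transition_classes F) sigma <->
  exists2 s : E -> 'I_n, bijective s & forall e k, sigma (tr e k) = s e.
Proof.
move=> hn; split=> [[surj cls]|[s bij_s sE]].
  pose s e := sigma (tr e by_across).
  have sE e k : sigma (tr e k) = s e.
    apply/cls; exists (tr_class G e); last by rewrite !mem_tr_class eqxx.
    by rewrite transition_classesE imset_f ?inE.
  exists s => //; apply: inj_card_bij; last by rewrite card_ord hn.
  move=> e e' /cls[w]; rewrite transition_classesE => /imsetP[e0 _ ->].
  by rewrite !mem_tr_class => /andP[/eqP-> /eqP->].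
have [nu _ nuK] := bij_s; split=> [i|u u'].
  by exists (tr (nu i) by_across); rewrite sE nuK.
have [e [k ->]] := tr_surj u; have [e' [k' ->]] := tr_surj u'.
rewrite !sE; split=> [/(bij_inj bij_s)<-|[w]].
  exists (tr_class G e); last by rewrite !mem_tr_class eqxx.
  by rewrite transition_classesE imset_f ?inE.
rewrite transition_classesE => /imsetP[e0 _ ->].
by rewrite !mem_tr_class => /andP[/eqP-> /eqP->].
Qed.

(** A basis inside the union of [T_1] and [T_2] is recovered by [select] from the numbers of the
    edges where it meets [T_2]. *)
Lemma matroid_setsystem_framed (n : nat) (q : E -> frame) (s : E -> 'I_n) sigma :
    (forall e, frame_uniq (q e)) -> bijective s ->
    (forall e k, sigma (tr e k) = s e) ->
  matroid_setsystem (graph_3matroid F) (frame_transversals q) sigma =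
  framed_system (basis G) q s.
Proof.
move=> uq bij_s sE; have inj_s := bij_inj bij_s; have [nu _ nuK] := bij_s.
have q12 e : (q e).1.1 != (q e).1.2.
  by have := uq e; rewrite /frame_uniq /= !inE negb_or => /andP[/andP[]].
have imE t : sigma @: (transversal_of t :&: transversal_of [ffun e => (q e).1.2]) =
    [set s e | e in [set e | t e == (q e).1.2]].
  apply/setP=> i; apply/imsetP/imsetP=> [[u]|[e]].
    have [e [k ->]] := tr_surj u; rewrite inE !mem_transversal_of ffunE.
    by case/andP=> /eqP-> te ->; exists e; rewrite ?inE ?sE.
  rewrite inE => /eqP te ->; exists (tr e (t e)); last by rewrite sE.
  by rewrite inE !mem_transversal_of ffunE te eqxx.
apply/setP=> I; rewrite inE; apply/imsetP/idP.
  case=> X; rewrite inE bases_graph_3matroid => /andP[/imsetP[t bt ->] /subsetP sub] ->.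
  rewrite inE in bt; rewrite imE; congr (basis G _): bt; apply/ffunP=> e.
  rewrite ffunE mem_imset // inE.
  have /sub : tr e (t e) \in transversal_of t by rewrite mem_transversal_of.
  rewrite inE !mem_transversal_of !ffunE => /orP[]/eqP te; rewrite te ?eqxx //.
  by rewrite (negPf (q12 e)).
move=> bI; exists (transversal_of (select q s I)).
  rewrite inE bases_graph_3matroid imset_f ?inE //.
  apply/subsetP=> u; have [e [k ->]] := tr_surj u.
  rewrite inE !mem_transversal_of !ffunE => /eqP->.
  by case: ifP; rewrite eqxx ?orbT.
rewrite imE; apply/setP=> i; rewrite -[i]nuK mem_imset // inE ffunE.
by case: (_ \in I); rewrite ?eqxx // (negPf (q12 _)).
Qed.

End MedialMatroid.

Theorem theorem6p3 (V E : finType) (G : ribbon_graph V E) (n : nat)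
    (hn : #|E| = n) (o : E -> 'I_n) (ho : bijective o) :
  forall D' : setsystem n,
    Orb (delta_matroid G o) D' <->
    exists (tau' : {set transition (medial_graph G)} *
                   {set transition (medial_graph G)} *
                   {set transition (medial_graph G)})
           (sigma' : transition (medial_graph G) -> 'I_n),
      [/\ transversal_3tuple (transition_classes (medial_graph G)) tau',
          projection (transition_classes (medial_graph G)) sigma' &
          D' = matroid_setsystem (graph_3matroid (medial_graph G)) tau' sigma'].
Proof.
move=> D'; rewrite delta_matroid_framed.
apply: iff_trans (Orb_framed_system (@basis_tight _ _ G) D' ho _) _ => //.
split=> [[q [s [uq bij_s ->]]]|[_ [sigma [/transversal_3tupleP[q uq ->] pr ->]]]].
  (* [ed] returns the edge underlying a transition, so that a numbering of edges composed with it is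
     a projection. *)
  have [ed edP] : exists ed : transition (medial_graph G) -> E,
      forall u, exists k, u = tr G (ed u) k.
    exact: (fin_all_exists (P := fun u e => exists k, u = tr G e k) (@tr_surj _ _ G)).
  have sE e k : s (ed (tr G e k)) = s e.
    by have [k' /tr_inj[<-]] := edP (tr G e k).
  exists (frame_transversals G q), (s \o ed); split.
  - by apply/transversal_3tupleP; exists q.
  - by apply/(projectionP _ hn); exists s.
  by rewrite (matroid_setsystem_framed uq bij_s sE).
have /(projectionP _ hn)[s bij_s sE] := pr.
by exists q, s; split=> //; apply: matroid_setsystem_framed.
Qed.
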